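(* Let $n\geq 4$ and let $T_n$ be a tree on $n$ vertices. Then $$\mathrm{QEC}(P_n)\leq \mathrm{QEC}(T_n)\leq \mathrm{QEC}(K_{1,n-1}).$$ Moreover, $\mathrm{QEC}(P_n)=\mathrm{QEC}(T_n)$ holds if and only if $T_n=P_n$ (i.e. $T_n$ is isomorphic to $P_n$), and $\mathrm{QEC}(T_n)=\mathrm{QEC}(K_{1,n-1})$ holds if and only if $T_n=K_{1,n-1}$ (i.e. $T_n$ is isomorphic to $K_{1,n-1}$).
   Context: All graphs are finite, simple, connected and unweighted. For a graph $G=(V,E)$, the distance matrix $D_G$ is the real symmetric $V\times V$ matrix whose $(v,w)$ entry is the length of a shortest path joining $v$ and $w$ (and $0$ if $v=w$). Let $C(V)$ be the space of real-valued functions on $V$, with canonical inner product $\langle\cdot,\cdot\rangle$, and let $e\in C(V)$ be the constant function $1$. For a graph $G$ with at least two vertices, the quadratic embedding constant is $$\mathrm{QEC}(G)=\max\{\langle f,D_Gf\rangle : f\in C(V),\ \langle f,f\rangle=1,\ \langle e,f\rangle=0\}.$$ $P_n$ is the path graph on $n$ vertices and $K_{1,n-1}$ is the star graph on $n$ vertices. *)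

(* Defs.v *)
From HB Require Import structures.
From mathcomp Require Import all_boot all_order all_algebra.
From mathcomp Require Import all_classical all_reals all_analysis.

Set Implicit Arguments.
Unset Strict Implicit.
Unset Printing Implicit Defensive.

Import Order.TTheory GRing.Theory Num.Theory.
Import numFieldNormedType.Exports.

Local Open Scope ring_scope.

Record sgraph := SGraph {
  vertex :> finType;
  adj : rel vertex;
  adj_sym : symmetric adj;
  adj_irr : irreflexive adj }.

Definition connected_graph (G : sgraph) : Prop :=
  forall x y : G, connect (@adj G) x y.

(* In mathcomp, [:: x; y] is a cycle as soon as x and y are adjacent; the
   cycles of graph theory are the duplicate-free ones of length at least 3. *)
Definition acyclic_graph (G : sgraph) : Prop :=
  forall c : seq G, ucycle (@adj G) c -> (size c < 3)%N.

Definition is_tree (G : sgraph) : Prop :=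
  connected_graph G /\ acyclic_graph G.

Definition graph_iso (G H : sgraph) : Prop :=
  exists2 f : G -> H, bijective f & forall x y, adj (f x) (f y) = adj x y.

Section Distance.
Variable G : sgraph.

Definition has_walk (k : nat) (x y : G) : bool :=
  [exists p : k.-tuple G, path (@adj G) x p && (last x p == y)].

(* The least k < #|G| such that some walk of length k joins x to y (and the
   junk value #|G| when x and y are not connected). *)
Definition gdist (x y : G) : nat :=
  find (fun k => has_walk k x y) (iota 0 #|G|).

Lemma has_walkP k x y :
  reflect (exists p : seq G,
             [/\ path (@adj G) x p, last x p = y & size p = k])
          (has_walk k x y).
Proof.
apply: (iffP existsP) => [[p /andP[xp /eqP lp]]|[p [xp lp sp]]].
  by exists p; rewrite size_tuple.
have sp' : size p == k by apply/eqP.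
by exists (Tuple sp'); rewrite /= xp lp eqxx.
Qed.

Lemma gdist_shortest x y : connect (@adj G) x y ->
  (exists p : seq G,
     [/\ path (@adj G) x p, last x p = y & size p = gdist x y]) /\
  (forall p : seq G, path (@adj G) x p -> last x p = y ->
     (gdist x y <= size p)%N).
Proof.
move=> /connectP[q xq yq].
move: yq; have [p' xp' up' _] := shortenP xq => lp'.
have sp' : (size p' < #|G|)%N.
  by have /= := max_card (mem (x :: p')); rewrite (card_uniqP up').
set P := fun k => has_walk k x y.
have hasP : has P (iota 0 #|G|).
  apply/hasP; exists (size p'); first by rewrite mem_iota.
  by apply/has_walkP; exists p'.
have ltf : (gdist x y < #|G|)%N.
  by move: hasP; rewrite has_find size_iota.
split.
  by have := nth_find 0 hasP; rewrite nth_iota// add0n => /has_walkP.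
move=> p xp lp; rewrite leqNgt; apply/negP => sp.
have := @before_find _ 0 P (iota 0 #|G|) _ sp.
rewrite nth_iota ?(ltn_trans sp ltf)// add0n => /has_walkP; apply.
by exists p.
Qed.

End Distance.

Section QEC.
Variables (R : realType) (G : sgraph).

Definition inner (f g : {ffun G -> R}) : R := \sum_v f v * g v.

Definition ones : {ffun G -> R} := [ffun => 1].

Definition dist_entry (v w : G) : R := (gdist v w)%:R.

Definition dist_op (f : {ffun G -> R}) : {ffun G -> R} :=
  [ffun v => \sum_w dist_entry v w * f w].

Definition admissible : set {ffun G -> R} :=
  [set f | inner f f = 1 /\ inner ones f = 0]%classic.

(* The library supremum is total; QEC_is_max below shows that it is attained,
   hence a maximum, as soon as G has at least two vertices. *)
Definition QEC : R := sup [set inner f (dist_op f) | f in admissible]%classic.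

Let vec (u : 'rV[R]_#|G|) : {ffun G -> R} := [ffun x => u 0 (enum_rank x)].

Let vecK (f : {ffun G -> R}) : vec (\row_i f (enum_val i)) = f.
Proof. by apply/ffunP => x; rewrite ffunE mxE enum_rankK. Qed.

Let inner_continuous (F H : 'rV[R]_#|G| -> {ffun G -> R}) :
  (forall x, continuous (fun u => F u x)) ->
  (forall x, continuous (fun u => H u x)) ->
  continuous (fun u => inner (F u) (H u)).
Proof.
move=> cF cH; apply: continuous_big => [|x _ u]; first exact: add_continuous.
exact: continuousM (cF x u) (cH x u).
Qed.

Let vec_continuous x : continuous (fun u => vec u x).
Proof.
rewrite (_ : (fun u => _) = (fun u : 'rV[R]_#|G| => u 0 (enum_rank x))).
  exact: coord_continuous.
by apply/funext => u; rewrite ffunE.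
Qed.

Let dist_op_continuous x : continuous (fun u => dist_op (vec u) x).
Proof.
rewrite (_ : (fun u => _) = (fun u => inner [ffun w => dist_entry x w] (vec u))).
  apply: inner_continuous; last exact: vec_continuous.
  by move=> w; exact: cst_continuous.
apply/funext => u; rewrite ffunE.
by apply: eq_bigr => w _; rewrite [in RHS]ffunE.
Qed.

Let admissible_nonempty : (1 < #|G|)%N -> (admissible !=set0)%classic.
Proof.
case/card_gt1P => a [b [_ _ neq_ab]].
pose c : R := (Num.sqrt 2)^-1.
exists [ffun x => c * ((x == a)%:R - (x == b)%:R)]; split.
  rewrite /inner (bigD1 a)//= (bigD1 b)/=; last by rewrite eq_sym.
  rewrite big1 => [|x /andP[/negbTE xa /negbTE xb]].
    rewrite !ffunE !eqxx (eq_sym b a) (negbTE neq_ab) addr0 subr0 sub0r !mulr1 mulrN1.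
    rewrite mulrN mulNr opprK -expr2 exprVn sqr_sqrtr ?ler0n// -mulr2n.
    by rewrite -[_ *+ 2 in LHS]mulr_natr mulVf// pnatr_eq0.
  by rewrite !ffunE xa xb subr0 mulr0 mul0r.
rewrite /inner (bigD1 a)//= (bigD1 b)/=; last by rewrite eq_sym.
rewrite big1 => [|x /andP[/negbTE xa /negbTE xb]].
  by rewrite !ffunE !eqxx (eq_sym b a) (negbTE neq_ab) addr0 subr0 sub0r !mul1r
    mulrN1 mulr1 subrr.
by rewrite !ffunE xa xb subr0 mulr0 mulr0.
Qed.

Lemma QEC_is_max : (1 < #|G|)%N ->
  (exists2 f, admissible f & inner f (dist_op f) = QEC) /\
  (forall f, admissible f -> inner f (dist_op f) <= QEC).
Proof.
move=> /admissible_nonempty [f0 f0A].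
pose A := [set u | admissible (vec u)]%classic.
pose q u := inner (vec u) (dist_op (vec u)).
have A0 : (A !=set0)%classic.
  by exists (\row_i f0 (enum_val i)); rewrite /A /= vecK.
have clA : closed A.
  apply: closedI.
    apply: (@closed_comp _ _ (fun u => inner (vec u) (vec u)) [set 1]%classic).
      by move=> u _; apply: inner_continuous; exact: vec_continuous.
    exact: closed_eq.
  apply: (@closed_comp _ _ (fun u => inner ones (vec u)) [set 0]%classic).
    move=> u _; apply: inner_continuous; last exact: vec_continuous.
    by move=> x; exact: cst_continuous.
  exact: closed_eq.
have bdA : bounded_set A.
  exists 1; split=> [|M M1 u [uu _]]; first exact: real1.
  rewrite /= [leLHS]/Num.norm /= mx_normrE; apply: bigmax_le => [|[i j] _ /=].
    by apply: ltW; apply: lt_trans M1.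
  apply: le_trans (ltW M1); rewrite ord1 -(@expr_le1 _ 2)// real_normK ?num_real//.
  rewrite -uu /inner (bigD1 (enum_val j))//= ffunE enum_valK -expr2 lerDl.
  by apply: sumr_ge0 => x _; rewrite -expr2 sqr_ge0.
have cq : {within A, continuous q}%classic.
  apply: continuous_subspaceT; apply: inner_continuous.
    exact: vec_continuous.
  exact: dist_op_continuous.
have [u uA umax] := EVT_max_rV A0 (bounded_closed_compact bdA clA) cq.
have {}umax f : admissible f -> inner f (dist_op f) <= q u.
  move=> fA; rewrite -[f]vecK; apply: (umax (\row_i f (enum_val i))).
  by rewrite inE /A /= vecK.
have uAd : admissible (vec u) by rewrite inE in uA.
have qE : QEC = q u.
  apply/eqP; rewrite eq_le; apply/andP; split.
    by apply: ge_sup => [|_ [f fA <-]]; [exists (q u), (vec u) | exact: umax].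
  apply: ub_le_sup; last by exists (vec u).
  by exists (q u) => _ [f fA <-]; exact: umax.
by split=> [|f fA]; rewrite qE; [exists (vec u) | exact: umax].
Qed.

End QEC.

Section Examples.

Definition path_adj n : rel 'I_n :=
  fun i j => (i.+1 == j :> nat) || (j.+1 == i :> nat).

Fact path_adj_sym n : symmetric (@path_adj n).
Proof. by move=> i j; rewrite /path_adj orbC. Qed.

Fact path_adj_irr n : irreflexive (@path_adj n).
Proof. by move=> i; rewrite /path_adj orbb eqn_leq ltnn. Qed.

Definition path_graph n : sgraph :=
  SGraph (@path_adj_sym n) (@path_adj_irr n).

Definition bip_adj m n : rel ('I_m + 'I_n)%type :=
  fun u v => match u, v with
             | inl _, inr _ | inr _, inl _ => true
             | _, _ => false
             end.

Fact bip_adj_sym m n : symmetric (@bip_adj m n).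
Proof. by do 2 case. Qed.

Fact bip_adj_irr m n : irreflexive (@bip_adj m n).
Proof. by case. Qed.

Definition complete_bipartite m n : sgraph :=
  SGraph (@bip_adj_sym m n) (@bip_adj_irr m n).

End Examples.

(* Main.v *)
Require Import Defs.
From mathcomp Require Import all_boot all_order all_algebra.
From mathcomp Require Import all_classical all_reals all_analysis.
From mathcomp Require Import perm zify ring lra.

Set Implicit Arguments.
Unset Strict Implicit.
Unset Printing Implicit Defensive.

Import Order.TTheory GRing.Theory Num.Theory.
Local Open Scope ring_scope.

(** For functions f of sum 0, the distance matrix D of a tree inverts the
    Laplacian L up to a factor: L (D f) = - 2 f (tree_laplacian_dist_op). This is
    local, because from each vertex there is exactly one step towards a given
    other vertex and all other steps lead away from it (tree_unique_next).
    Hence QEC(T) = - 2 / mu(T), where mu is the greatest eigenvalue of L, and the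
    theorem says that mu is smallest for the path and greatest for the star.
    Eigenvalues are avoided: nonnegativity of the Dirichlet form at D f + t f
    yields tree_dist_form_le, which transfers upper bounds for the Dirichlet form
    of f to the distance form.

    Star. The Laplacians of a graph and of its complement sum to n on functions
    of sum 0, so mu <= n and QEC(T) <= - 2 / n (tree_QEC_le). Equality needs a
    nonzero f of sum 0 that is equal at non-adjacent vertices; then the
    complement of T is disconnected, and T, being without 4-cycles, has a vertex
    adjacent to all others (tree_QEC_extremal_center). The star reaches - 2 / n,
    as a test vector shows (QEC_ge_star).

    Path. If all degrees are at most 2 then mu < 4, so QEC < - 1 / 2
    (tree_QEC_lt_degree2), and the tree is a path (tree_iso_path_graph).
    Otherwise some vertex has three neighbours, and the same test vector, on
    K_(1,3), gives QEC(T) >= - 1 / 2. *)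

(** * Distances in connected graphs *)

Lemma gdist_le (G : sgraph) (x y : G) (p : seq G) :
  path (@adj G) x p -> last x p = y -> (gdist x y <= size p)%N.
Proof.
move=> xp lp; have xy : connect (@adj G) x y by apply/connectP; exists p.
by have [_] := gdist_shortest xy; apply.
Qed.

Lemma gdist_geodesic (G : sgraph) (conG : connected_graph G) (x y : G) :
  exists p, [/\ path (@adj G) x p, last x p = y & size p = gdist x y].
Proof. by have [] := gdist_shortest (conG x y). Qed.

Lemma gdist_refl (G : sgraph) (x : G) : gdist x x = 0%N.
Proof. by apply/eqP; rewrite -leqn0; exact: (@gdist_le G x x [::]). Qed.

Lemma gdist_eq0 (G : sgraph) (conG : connected_graph G) (x y : G) :
  (gdist x y == 0%N) = (x == y).
Proof.
apply/eqP/eqP=> [d0|->]; last exact: gdist_refl.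
by have [[|z p] [_ /= lp sp]] := gdist_geodesic conG x y; rewrite ?d0 in sp.
Qed.

Lemma gdist_sym_le (G : sgraph) (conG : connected_graph G) (x y : G) :
  (gdist y x <= gdist x y)%N.
Proof.
have [p [xp <- <-]] := gdist_geodesic conG x y.
rewrite -(size_belast x) -size_rev; apply: gdist_le.
  rewrite rev_path (eq_path (e' := @adj G))// => u v /=; exact: adj_sym.
by case: p xp => //= a p _; rewrite rev_cons last_rcons.
Qed.

Lemma gdist_sym (G : sgraph) (conG : connected_graph G) (x y : G) :
  gdist x y = gdist y x.
Proof. by apply/eqP; rewrite eqn_leq !gdist_sym_le. Qed.

Lemma gdist_adj_le (G : sgraph) (conG : connected_graph G) (u v w : G) :
  adj u v -> (gdist u w <= (gdist v w).+1)%N.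
Proof.
move=> uv; have [p [vp lp <-]] := gdist_geodesic conG v w.
by apply: (@gdist_le G u w (v :: p)); rewrite /= ?uv.
Qed.

Lemma gdist_next (G : sgraph) (conG : connected_graph G) (x y : G) :
  x != y -> exists2 u, adj x u & gdist x y = (gdist u y).+1.
Proof.
move=> xy; have [[|u p] [/= + lp sp]] := gdist_geodesic conG x y.
  by rewrite lp eqxx in xy.
move=> /andP[xu up]; exists u => //; apply/eqP; rewrite eqn_leq gdist_adj_le//=.
by rewrite -sp; exact: gdist_le.
Qed.

Lemma gdist_lt_card (G : sgraph) (conG : connected_graph G) (x y : G) :
  (gdist x y < #|G|)%N.
Proof.
have [p [+ + _]] := gdist_geodesic conG x y.
case/shortenP => q xq uq _ lq; apply: leq_ltn_trans (gdist_le xq lq) _.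
by have /= := max_card (mem (x :: q)); rewrite (card_uniqP uq).
Qed.

Lemma gdist_adj (G : sgraph) (conG : connected_graph G) (u v : G) :
  adj u v -> gdist u v = 1%N.
Proof.
move=> uv; apply/eqP; rewrite eqn_leq lt0n gdist_eq0//.
rewrite (leq_trans (gdist_adj_le conG v uv)) ?gdist_refl//=.
by apply: contraTneq uv => ->; rewrite adj_irr.
Qed.

Lemma gdist_ge2 (G : sgraph) (conG : connected_graph G) (u v : G) :
  u != v -> ~~ adj u v -> (2 <= gdist u v)%N.
Proof.
move=> uv; apply: contraR; rewrite -ltnNge ltnS => le1.
have [w uw] := gdist_next conG uv.
move=> dE; move: le1; rewrite dE ltnS leqn0 gdist_eq0// => /eqP <- //.
Qed.

(** * Trees *)

Lemma tree_no_triangle (G : sgraph) (treeG : is_tree G) (u v w : G) :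
  adj u v -> adj v w -> adj u w -> False.
Proof.
move=> uv vw uw; suff /treeG.2 : ucycle (@adj G) [:: u; v; w] by [].
rewrite /ucycle /= uv vw (adj_sym w) uw !inE negb_or /= andbT.
have ne a b : adj a b -> a != b by apply: contraTneq => ->; rewrite adj_irr.
by rewrite !ne.
Qed.

Lemma tree_no_square (G : sgraph) (treeG : is_tree G) (a b a' b' : G) :
  a != a' -> b != b' -> adj a b -> adj a b' -> adj a' b -> adj a' b' -> False.
Proof.
move=> aa' bb' ab ab' a'b a'b'.
suff /treeG.2 : ucycle (@adj G) [:: a; b; a'; b'] by [].
rewrite /ucycle /= ab (adj_sym b) a'b a'b' (adj_sym b') ab' !inE !negb_or /=.
have ne x y : adj x y -> x != y by apply: contraTneq => ->; rewrite adj_irr.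
by rewrite aa' bb' !ne// adj_sym.
Qed.

(** Geodesics to w that start at two neighbours of v which are no farther from
    w than v must avoid v; if the neighbours differed, joining them through w
    and through v would produce a cycle. So from v there is a single step
    towards w, and no neighbour of v is at the same distance from w as v. *)
Lemma tree_unique_next (G : sgraph) (treeG : is_tree G) (v w u u' : G) :
  adj v u -> adj v u' -> (gdist u w <= gdist v w)%N ->
  (gdist u' w <= gdist v w)%N -> u = u'.
Proof.
have [conG acG] := treeG.
(* Adjacency in the graph without the vertex v. *)
pose e := [rel x y : G | [&& adj x y, x != v & y != v]].
have symE : symmetric e by move=> x y /=; rewrite adj_sym [(x != v) && _]andbC.
have toW x : adj v x -> (gdist x w <= gdist v w)%N -> connect e x w.
  move=> vx le; have [p [xp lp sp]] := gdist_geodesic conG x w.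
  have vp : v \notin x :: p.
    rewrite inE negb_or; apply/andP; split.
      by apply: contraTneq vx => ->; rewrite adj_irr.
    apply/negP => vp; case/splitPr: vp xp lp sp => p1 p2.
    rewrite cat_path last_cat /= => /and3P[_ _ vp2] lp2.
    have := gdist_le vp2 lp2; rewrite size_cat /=; lia.
  apply/connectP; exists p => //.
  elim: p x xp vp {vx le lp sp} => //= y p IH x /andP[xy yp].
  rewrite inE negb_or eq_sym => /andP[xv vp].
  rewrite xy xv IH// andbT /=; move: vp; rewrite inE negb_or eq_sym.
  by case/andP.
move=> vu vu' le le'; apply/eqP/negPn/negP => uu'.
have /connectP[p0] : connect e u u'.
  apply: connect_trans (toW _ vu le) _.
  by rewrite (sym_connect_sym symE); exact: toW.
case/shortenP => p up Up _ lp.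
suff /acG : ucycle (@adj G) [:: v, u & p].
  by case: p {up Up} lp => [/esym/eqP|//]; rewrite (negbTE uu').
have vNup : v \notin u :: p.
  rewrite inE negb_or; apply/andP; split.
    by apply: contraTneq vu => ->; rewrite adj_irr.
  apply/negP => vp; case/splitPr: vp up => p1 p2.
  by rewrite cat_path /= eqxx !andbF.
apply/andP; split; last by rewrite cons_uniq vNup Up.
rewrite /= vu rcons_path /= -lp (adj_sym u') vu' andbT.
by apply: sub_path up => x y /= /andP[].
Qed.

(** In a pair of vertices at maximal distance, each neighbour of one end is no
    farther from the other end, hence lies on the unique step towards it. *)
Lemma tree_leaf (G : sgraph) (treeG : is_tree G) (G1 : (1 < #|G|)%N) :
  exists x : G, forall u u', adj x u -> adj x u' -> u = u'.
Proof.
have [conG _] := treeG.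
have /card_gt1P[a [b [_ _ ab]]] := G1.
case: (@arg_maxnP _ (a, b) predT (fun q => gdist q.1 q.2) isT) => -[x y] /= _.
move=> mx; exists x => u u' xu xu'.
apply: (tree_unique_next treeG (w := y) xu xu').
  exact: (mx (u, y)).
exact: (mx (u', y)).
Qed.

(** The distance to a leaf r is the isomorphism. It is injective: if two vertices
    at distance k + 1 have the same neighbour u at distance k, then u has three
    neighbours, unless u is the leaf r, which has just one. *)
Lemma tree_iso_path_graph (G : sgraph) (treeG : is_tree G) (G1 : (1 < #|G|)%N)
    (deg2 : forall x : G, (#|adj x| <= 2)%N) :
  graph_iso G (path_graph #|G|).
Proof.
have [conG _] := treeG.
have [r leafr] := tree_leaf treeG G1.
have level_inj k (v v' : G) : gdist v r = k -> gdist v' r = k -> v = v'.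
  elim: k v v' => [|k IH] v v' dv dv'.
    by move/eqP: dv dv' => + /eqP; rewrite !gdist_eq0// => /eqP -> /eqP ->.
  have next x : gdist x r = k.+1 -> exists2 u, adj x u & gdist u r = k.
    move=> dx; have xr : x != r by rewrite -gdist_eq0// dx.
    by have [u xu] := gdist_next conG xr; rewrite dx => -[du]; exists u.
  have [u vu du] := next _ dv; have [u' vu' du'] := next _ dv'.
  have {u' vu' du'} v'u : adj v' u by rewrite (IH u u').
  have [ur|ur] := eqVneq u r.
    by apply: leafr; rewrite -ur adj_sym.
  have [t ut dt] := gdist_next conG ur.
  apply/eqP; apply: contraTT (deg2 u) => vv'.
  rewrite -ltnNge; apply/card_gt2P; exists v, v', t.
  rewrite -!topredE /= (adj_sym u v) (adj_sym u v') vu v'u ut vv'; split => //.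
  have tw w : gdist w r = k.+1 -> t != w.
    by move=> dw; apply: contra_eq_neq dw => <-; rewrite -du dt; lia.
  by rewrite tw// eq_sym tw.
pose f x : path_graph #|G| := Ordinal (gdist_lt_card conG x r).
have injf : injective f by move=> x y [dxy]; exact: level_inj (erefl _) (esym dxy).
exists f; first by apply: inj_card_bij injf _; rewrite card_ord.
have adjf x y : (gdist x r).+1 = gdist y r -> adj y x.
  move=> dE; have yr : y != r by rewrite -gdist_eq0// -dE.
  have [u yu] := gdist_next conG yr; rewrite -dE => -[du].
  by rewrite (level_inj _ _ _ du (erefl _)).
move=> x y /=; rewrite /path_adj /=; apply/orP/idP => [[]/eqP /adjf//|xy].
  by rewrite adj_sym.
have ne : gdist x r != gdist y r.
  by apply: contraTneq xy => /level_inj -/(_ _ erefl) ->; rewrite adj_irr.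
have := gdist_adj_le conG r xy; rewrite adj_sym in xy.
have := gdist_adj_le conG r xy; lia.
Qed.

(** In a cycle of the path graph, both neighbours of the greatest vertex m would
    have to be m - 1. *)
Lemma path_graph_tree (n : nat) : is_tree (path_graph n).
Proof.
split=> [x y|c /andP[cyc uc]].
  have sym := sym_connect_sym (@path_adj_sym n).
  wlog xy : x y / (x <= y)%N.
    by move=> H; have [/H//|/ltnW/H] := leqP x y; rewrite /= sym.
  move: {2}(y - x)%N (erefl (y - x)%N) => k.
  elim: k x xy => [|k IH] x xy yx.
    by suff -> : x = y by []; apply: val_inj => /=; lia.
  have xn : (x.+1 < n)%N by have := ltn_ord y; lia.
  apply: (@connect_trans _ _ (Ordinal xn)); last by apply: IH => /=; lia.
  by apply: connect1; rewrite /= /path_adj /= eqxx.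
case: c cyc uc => // c0 c' cyc uc.
have [m mc mmax] : exists2 m, m \in c0 :: c' &
    forall z : 'I_n, z \in c0 :: c' -> (z <= m)%N.
  by case: (@arg_maxnP _ c0 (mem (c0 :: c')) (@nat_of_ord n)
    (mem_head _ _)) => m; exists m.
have [i c2 rotE] := rot_to mc.
have := cyc; rewrite -(rot_cycle i) rotE => {}cyc.
have := uc; rewrite -(rot_uniq i) rotE => {}uc.
have {}mmax z : z \in m :: c2 -> (z <= m)%N by rewrite -rotE mem_rot; exact: mmax.
rewrite -(size_rot i) rotE.
case: c2 cyc uc mmax {rotE} => // u p; rewrite (cycle_path m) /=.
move=> /and3P[lm mu up] /and3P[mup Nup Up] mmax.
have below z : z \in u :: p -> path_adj m z -> z = m.-1 :> nat.
  move=> zup; have := mmax z; rewrite inE zup orbT => /(_ isT).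
  by rewrite /path_adj => ? /orP[]/eqP; lia.
(* m is adjacent both to its successor u and to its predecessor last u p. *)
have lu : last u p = u.
  apply: val_inj; rewrite /= (below u)// ?mem_head//.
  by apply: below; [exact: mem_last|rewrite path_adj_sym].
by case: p lu Nup {lm up mup Up mmax below} => //= a p lu; rewrite -{1}lu mem_last.
Qed.

Lemma path_graph_degree (n : nat) (i : path_graph n) : (#|adj i| <= 2)%N.
Proof.
rewrite leqNgt; apply/negP => /card_gt2P[x [y [z []]]].
rewrite -!topredE /= /path_adj -!(inj_eq val_inj) /= => -[ix iy iz] [xy yz zx].
by case/orP: ix => /eqP; case/orP: iy => /eqP; case/orP: iz => /eqP; lia.
Qed.

(** The other vertices are pairwise non-adjacent, since an edge between two of
    them would close a triangle with c. Hence any bijection that sends c to the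
    centre of the star is an isomorphism; a transposition arranges that. *)
Lemma tree_iso_star (G : sgraph) (treeG : is_tree G) (c : G)
    (cen : forall x, x != c -> adj c x) :
  graph_iso G (complete_bipartite 1 (#|G| - 1)).
Proof.
set K := complete_bipartite _ _.
have cardK : #|G| = #|K|.
  rewrite card_sum !card_ord; have : (0 < #|G|)%N by apply/card_gt0P; exists c.
  by lia.
pose b x : K := enum_val (cast_ord cardK (enum_rank x)).
have bijb : bijective b.
  exists (fun y => enum_val (cast_ord (esym cardK) (enum_rank y))) => x;
  by rewrite /b enum_valK ?cast_ordK ?cast_ordKV enum_rankK.
pose z : K := inl ord0.
pose f x := tperm (b c) z (b x).
have bijf : bijective f.
  exact: bij_comp (injF_bij (@perm_inj _ (tperm (b c) z))) bijb.
have fz x : (f x == z) = (x == c).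
  have fc : f c = z by rewrite /f tpermL.
  by rewrite -fc (inj_eq (bij_inj bijf)).
have adjK (u v : K) : adj u v = ((u == z) != (v == z)).
  by case: u => [u|u]; case: v => [v|v] //=; rewrite /z ?(ord1 u) ?(ord1 v) ?eqxx.
exists f => // x y; rewrite adjK !fz.
have [->|xc] := eqVneq x c; have [->|yc] := eqVneq y c; rewrite ?adj_irr//=.
- by rewrite cen.
- by rewrite adj_sym cen.
- by apply/esym/negP => xy; apply: (tree_no_triangle treeG (cen _ xc) xy (cen _ yc)).
Qed.

(** * Invariance under isomorphism *)

Lemma graph_iso_sym (G H : sgraph) : graph_iso G H -> graph_iso H G.
Proof.
case=> f [g fK gK] adjf; exists g; first by exists f.
by move=> x y; rewrite -adjf !gK.
Qed.

Lemma has_walk_homo (G H : sgraph) (f : G -> H)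
    (homf : {homo f : x y / adj x y}) k x y :
  has_walk k x y -> has_walk k (f x) (f y).
Proof.
move=> /has_walkP[p [xp lp sp]]; apply/has_walkP; exists (map f p).
by rewrite last_map lp size_map sp; split=> //; apply: homo_path xp.
Qed.

Lemma gdist_iso (G H : sgraph) (f : G -> H) :
  bijective f -> (forall x y, adj (f x) (f y) = adj x y) ->
  forall x y, gdist (f x) (f y) = gdist x y.
Proof.
move=> bijf adjf x y; have [g fK gK] := bijf.
rewrite /gdist (bij_eq_card bijf); apply: eq_find => k.
apply/idP/idP; last by apply: has_walk_homo => u v; rewrite adjf.
move=> /(has_walk_homo (f := g)); rewrite !fK; apply => u v.
by rewrite -adjf !gK.
Qed.

Lemma QEC_iso (R : realType) (G H : sgraph) : graph_iso G H -> QEC R G = QEC R H.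
Proof.
suff sub G' H' : graph_iso G' H' ->
    ([set inner f (dist_op f) | f in @admissible R G'] `<=`
     [set inner f (dist_op f) | f in @admissible R H'])%classic.
  move=> GH; congr (sup _); apply/seteqP; split; apply: sub => //.
  exact: graph_iso_sym.
move=> [h bijh adjh] _ [f [ff f0] <-]; have [g hK gK] := bijh.
have re (F : G' -> R) : \sum_x F x = \sum_y F (g y).
  by rewrite (reindex g)//; exists h => x _.
exists [ffun y => f (g y)].
  split; [rewrite -ff|rewrite -f0]; rewrite /inner [RHS]re;
  by apply: eq_bigr => y _; rewrite !ffunE.
rewrite /inner [RHS]re; apply: eq_bigr => y _; rewrite !ffunE; congr (_ * _).
rewrite [RHS]re; apply: eq_bigr => z _; rewrite ffunE /dist_entry.
by rewrite -(gdist_iso bijh adjh) !gK.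
Qed.

(** * The Dirichlet form of a tree *)

Lemma inner_ones (R : realType) (G : sgraph) (f : {ffun G -> R}) :
  inner (ones R G) f = \sum_x f x.
Proof. by apply: eq_bigr => x _; rewrite ffunE mul1r. Qed.

(** The sum runs over ordered pairs, so this is twice the Dirichlet form
    (the sum over edges) that belongs to the graph Laplacian. *)
Definition energy (R : realType) (G : sgraph) (f g : G -> R) : R :=
  \sum_u \sum_v (adj u v)%:R * ((f u - f v) * (g u - g v)).

(** Summation by parts: the energy is twice the form of the Laplacian. *)
Lemma energyE (R : realType) (G : sgraph) (f g : G -> R) :
  energy f g = 2 * \sum_u (\sum_v (adj u v)%:R * (f u - f v)) * g u.
Proof.
transitivity (\sum_u \sum_v (adj u v)%:R * (f u - f v) * g u
            - \sum_u \sum_v (adj u v)%:R * (f u - f v) * g v).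
  rewrite -sumrB; apply: eq_bigr => u _; rewrite -sumrB.
  by apply: eq_bigr => v _; ring.
rewrite [X in _ - X]exchange_big -sumrN -big_split mulr_sumr /=.
apply: eq_bigr => u _; rewrite mulr_suml -sumrN -big_split mulr_sumr /=.
by apply: eq_bigr => v _; rewrite adj_sym; ring.
Qed.

Lemma energy_ge0 (R : realType) (G : sgraph) (f : G -> R) : 0 <= energy f f.
Proof.
by apply: sumr_ge0 => u _; apply: sumr_ge0 => v _;
  rewrite mulr_ge0 ?ler0n// -expr2 sqr_ge0.
Qed.

Lemma energyDZ (R : realType) (G : sgraph) (f g : G -> R) (t : R) :
  energy (fun x => g x + t * f x) (fun x => g x + t * f x) =
  energy g g + 2 * t * energy g f + t ^+ 2 * energy f f.
Proof.
rewrite /energy !mulr_sumr -!big_split; apply: eq_bigr => u _.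
rewrite !mulr_sumr -!big_split; apply: eq_bigr => v _ /=.
by ring.
Qed.

Lemma sum_adj (R : realType) (G : sgraph) (u : G) :
  \sum_v (adj u v)%:R = #|adj u|%:R :> R.
Proof.
rewrite -sum1_card natr_sum [RHS]big_mkcond; apply: eq_bigr => v _.
by rewrite -topredE /=; case: adj.
Qed.

(** The Graham-Lovasz identity L D = -2 I + (2 - deg) e^T. For u distinct from w
    a single neighbour of u is closer to w by 1 and the deg u - 1 others are
    farther by 1; for u = w all neighbours are farther. *)
Lemma tree_laplacian_dist (R : realType) (G : sgraph) (treeG : is_tree G) (u w : G) :
  \sum_v (adj u v)%:R * (dist_entry R u w - dist_entry R v w) =
  2 - #|adj u|%:R - 2 * (u == w)%:R.
Proof.
have [conG _] := treeG.
have term v : (adj u v)%:R * (dist_entry R u w - dist_entry R v w) =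
    2 * (adj u v && (gdist v w < gdist u w)%N)%:R - (adj u v)%:R.
  case uv : (adj u v); last by rewrite /= !mul0r mulr0 subr0.
  rewrite /dist_entry /= mul1r.
  have d1 := gdist_adj_le conG w uv.
  have d2 : (gdist v w <= (gdist u w).+1)%N by apply: gdist_adj_le; rewrite ?(adj_sym v).
  have ne : gdist v w != gdist u w.
    apply/eqP => dvu; have [uw|uw] := eqVneq u w.
      move/eqP: dvu; rewrite uw gdist_refl gdist_eq0// => /eqP vw.
      by rewrite uw vw adj_irr in uv.
    have [u' uu' du'] := gdist_next conG uw.
    have vu' : v = u' by apply: (tree_unique_next treeG (w := w) uv uu'); lia.
    by move: du'; rewrite -vu' dvu; lia.
  case: ltnP => lt.
    have -> : gdist u w = (gdist v w).+1 by lia.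
    by rewrite -natr1 /=; ring.
  have -> : gdist v w = (gdist u w).+1 by lia.
  by rewrite -natr1 /=; ring.
under eq_bigr do rewrite term.
rewrite sumrB -mulr_sumr sum_adj.
have -> : \sum_v (adj u v && (gdist v w < gdist u w)%N)%:R = 1 - (u == w)%:R :> R.
  have [->|uw] := eqVneq u w.
    by rewrite gdist_refl big1 ?subrr// => v _; rewrite andbF.
  have [u' uu' du'] := gdist_next conG uw.
  rewrite (bigD1 u')//= uu' du' ltnSn big1 ?addr0 ?subr0// => v vu'.
  case uv : (adj u v) => //=; case: ltnP => // lt.
  by rewrite (tree_unique_next treeG (w := w) uv uu') ?eqxx// in vu'; lia.
by ring.
Qed.

(** On functions of sum 0 the rank-one term vanishes, so there D inverts the
    Laplacian up to the factor -2. *)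
Lemma tree_laplacian_dist_op (R : realType) (G : sgraph) (treeG : is_tree G)
    (f : {ffun G -> R}) (u : G) : inner (ones R G) f = 0 ->
  \sum_v (adj u v)%:R * (dist_op f u - dist_op f v) = - 2 * f u.
Proof.
move=> f0.
transitivity (\sum_w f w * \sum_v (adj u v)%:R * (dist_entry R u w - dist_entry R v w)).
  under [RHS]eq_bigr do rewrite mulr_sumr.
  rewrite [RHS]exchange_big; apply: eq_bigr => v _ /=.
  rewrite !ffunE -sumrB mulr_sumr; apply: eq_bigr => w _; ring.
under eq_bigr do rewrite tree_laplacian_dist//.
transitivity ((2 - #|adj u|%:R) * \sum_w f w - 2 * \sum_w (u == w)%:R * f w).
  rewrite !mulr_sumr -sumrB; apply: eq_bigr => w _; ring.
have -> : \sum_w f w = 0.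
  by rewrite -inner_ones.
rewrite (bigD1 u)//= eqxx big1 => [|w];
  last by rewrite eq_sym => /negbTE ->; rewrite mul0r.
by rewrite /=; ring.
Qed.

Lemma tree_energy_dist_op (R : realType) (G : sgraph) (treeG : is_tree G)
    (f h : {ffun G -> R}) : inner (ones R G) f = 0 ->
  energy (dist_op f) h = - 4 * inner f h.
Proof.
move=> f0; rewrite energyE /inner !mulr_sumr; apply: eq_bigr => u _.
by rewrite tree_laplacian_dist_op//; ring.
Qed.

(** This is the inequality energy (D f + t f) (D f + t f) >= 0. It turns an upper
    bound on the energy of f, i.e. on the greatest Laplacian eigenvalue, into an
    upper bound on the distance form. *)
Lemma tree_dist_form_le (R : realType) (G : sgraph) (treeG : is_tree G)
    (f : {ffun G -> R}) (t : R) : inner (ones R G) f = 0 ->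
  4 * inner f (dist_op f) <= t ^+ 2 * energy f f - 8 * t * inner f f.
Proof.
move=> f0; have := energy_ge0 (fun x => dist_op f x + t * f x).
rewrite energyDZ !tree_energy_dist_op//; lra.
Qed.

(** The Laplacians of a graph and of its complement add up to n I - J, and J
    kills functions of sum 0. The diagonal terms of the second sum vanish. *)
Lemma energy_complement (R : realType) (G : sgraph) (f : {ffun G -> R}) :
  inner (ones R G) f = 0 ->
  energy f f + \sum_u \sum_v (~~ adj u v)%:R * (f u - f v) ^+ 2 =
  2 * #|G|%:R * inner f f.
Proof.
move=> f0.
have s0 : \sum_w f w = 0.
  by rewrite -inner_ones.
transitivity (\sum_u \sum_v (f u * f u + f v * f v - 2 * (f u * f v))).
  rewrite -big_split; apply: eq_bigr => u _; rewrite -big_split.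
  by apply: eq_bigr => v _ /=; case: adj => /=; ring.
transitivity (\sum_u (#|G|%:R * (f u * f u) + inner f f)).
  apply: eq_bigr => u _; rewrite sumrB big_split sumr_const /=.
  by rewrite -!mulr_sumr s0 !mulr0 subr0 mulr_natl.
rewrite big_split sumr_const -mulr_sumr /= -mulr_natl.
by rewrite -/(inner f f); ring.
Qed.

(** The Laplacian and the signless Laplacian add up to twice the degree matrix;
    so the energy of a unit vector is at most 4 times the greatest
    degree. *)
Lemma energy_degree (R : realType) (G : sgraph) (f : {ffun G -> R}) :
  energy f f + \sum_u \sum_v (adj u v)%:R * (f u + f v) ^+ 2 =
  4 * \sum_u #|adj u|%:R * (f u * f u).
Proof.
pose S := \sum_u #|adj u|%:R * (f u * f u).
have E1 : \sum_u \sum_v (adj u v)%:R * (f u * f u) = S.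
  by apply: eq_bigr => u _; rewrite -mulr_suml sum_adj.
have E2 : \sum_u \sum_v (adj u v)%:R * (f v * f v) = S.
  rewrite exchange_big -E1; apply: eq_bigr => u _; apply: eq_bigr => v _.
  by rewrite adj_sym.
rewrite -/S; transitivity (2 * S + 2 * S); last by ring.
rewrite -{1}E1 -E2 !mulr_sumr -!big_split; apply: eq_bigr => u _ /=.
rewrite !mulr_sumr -!big_split; apply: eq_bigr => v _ /=; ring.
Qed.

(** * Bounds on the quadratic embedding constant *)

Lemma psum2_eq0 (R : realType) (I : finType) (F : I -> I -> R) :
  (forall u v, 0 <= F u v) -> \sum_u \sum_v F u v <= 0 -> forall u v, F u v = 0.
Proof.
move=> F0 le0 u v; apply/eqP; rewrite eq_le F0 andbT; apply: le_trans le0.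
rewrite (bigD1 u)//= (bigD1 v)//= -addrA lerDl addr_ge0// sumr_ge0// => w _.
exact: sumr_ge0.
Qed.

(** By complementation the energy of a unit vector is at most 2 n, and t = 2 / n
    is the optimal choice in the comparison of the distance form with it. *)
Lemma tree_QEC_le (R : realType) (G : sgraph) (treeG : is_tree G) :
  (1 < #|G|)%N -> QEC R G <= - 2 / #|G|%:R.
Proof.
move=> G1; have [[f [ff f0] <-] _] := QEC_is_max R G1.
have n0 : 0 < #|G|%:R :> R by rewrite ltr0n; lia.
have := tree_dist_form_le treeG (2 / #|G|%:R) f0.
have : energy f f <= 2 * #|G|%:R.
  have := energy_complement f0; rewrite ff mulr1 => <-; rewrite lerDl.
  by do 2 (apply: sumr_ge0 => ? _); rewrite mulr_ge0 ?ler0n// sqr_ge0.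
rewrite ff; set n := #|G|%:R in n0 *; move: (inner _ _) => q En.
have : (2 / n) ^+ 2 * energy f f <= 8 / n.
  have -> : 8 / n = (2 / n) ^+ 2 * (2 * n) by field; rewrite gt_eqF.
  by rewrite ler_wpM2l// sqr_ge0.
lra.
Qed.

(** If the bound is attained at f, then f has no energy on the complement, i.e.
    f is equal at non-adjacent vertices. So the vertices where f is positive
    are all adjacent to those where it is not; as a tree has no 4-cycle, one of
    these two classes is a single vertex. *)
Lemma tree_QEC_extremal_center (R : realType) (G : sgraph) (treeG : is_tree G) :
  (1 < #|G|)%N -> - 2 / #|G|%:R <= QEC R G ->
  exists c : G, forall x, x != c -> adj c x.
Proof.
move=> G1; have [[f [ff f0] <-] _] := QEC_is_max R G1 => geq.
have n0 : 0 < #|G|%:R :> R by rewrite ltr0n; lia.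
have E2 : 2 * #|G|%:R <= energy f f.
  have := tree_dist_form_le treeG (2 / #|G|%:R) f0.
  rewrite ff; set n := #|G|%:R in geq n0 *; move: (inner _ _) geq => q geq le.
  have : (2 / n) ^+ 2 * (2 * n) <= (2 / n) ^+ 2 * energy f f.
    have -> : (2 / n) ^+ 2 * (2 * n) = 8 / n by field; rewrite gt_eqF.
    lra.
  by rewrite ler_pM2l// exprn_gt0// divr_gt0.
have nadj u v : ~~ adj u v -> f u = f v.
  move=> uv; have /psum2_eq0 : \sum_u \sum_v (~~ adj u v)%:R * (f u - f v) ^+ 2 <= 0.
    by have := energy_complement f0; rewrite ff mulr1; lra.
  move=> /(_ (fun _ _ => mulr_ge0 (ler0n _ _) (sqr_ge0 _)) u v) /eqP.
  by rewrite uv mul1r sqrf_eq0 subr_eq0 => /eqP.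
pose A := [set x | 0 < f x].
have adjA a b : a \in A -> b \notin A -> adj a b.
  rewrite !inE => fa; apply: contraR => /nadj <- //.
have s0 : \sum_w f w = 0.
  by rewrite -inner_ones.
have [x0] : exists x, f x != 0.
  apply/existsP; apply: contraPT ff => /existsPn /= f_0.
  rewrite /inner big1 => [/eqP|x _]; first by rewrite eq_sym oner_eq0.
  by have /negPn/eqP -> := f_0 x; rewrite mulr0.
move=> fx0.
have [a aA] : exists a, a \in A.
  apply/existsP; apply: contraNT fx0 => /existsPn nA.
  have le0 x : 0 <= - f x by have := nA x; rewrite inE -leNgt oppr_ge0.
  have /eqP := s0; rewrite -oppr_eq0 -sumrN psumr_eq0// => /allP /(_ x0).
  by rewrite mem_index_enum oppr_eq0 => /(_ isT).
have [b bA] : exists b, b \notin A.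
  apply/existsP; apply: contraNT fx0 => /existsPn nA.
  have ge0 x : 0 <= f x by have := nA x; rewrite negbK inE => /ltW.
  have /eqP := s0; rewrite psumr_eq0// => /allP /(_ x0).
  by rewrite mem_index_enum => /(_ isT).
(* Either f is positive at a only, or it is nonpositive at b only. *)
have [onlya|] := boolP [forall x in A, x == a].
  exists a => x xa; apply: adjA => //.
  by apply: contra xa => xA; exact: (forall_inP onlya).
case/forall_inPn => a' a'A aa'.
exists b => x xb; rewrite adj_sym; apply: (adjA) => //.
apply: contraT => xA; exfalso.
by apply: (tree_no_square treeG aa' xb); exact: adjA.
Qed.

(** With degrees at most 2 the energy of a unit vector is at most 8. Equality
    would force f to change sign along every edge and to vanish at the vertices
    of degree less than 2; there is a leaf, so f would be 0 by connectedness. *)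
Lemma tree_QEC_lt_degree2 (R : realType) (G : sgraph) (treeG : is_tree G) :
  (1 < #|G|)%N -> (forall x : G, (#|adj x| <= 2)%N) -> QEC R G < - 1 / 2.
Proof.
move=> G1 deg2; have [[f [ff f0] <-] _] := QEC_is_max R G1.
rewrite ltNge; apply/negP => geq.
have E8 : 8 <= energy f f.
  have := tree_dist_form_le treeG (1 / 2) f0; rewrite ff; lra.
pose S1 := \sum_u \sum_v (adj u v)%:R * (f u + f v) ^+ 2.
pose S2 := \sum_u (2 - #|adj u|%:R) * (f u * f u).
have S12 : S1 + 4 * S2 <= 0.
  have := energy_degree f; rewrite -/S1.
  have : S2 = 2 * inner f f - \sum_u #|adj u|%:R * (f u * f u).
    rewrite /S2 /inner mulr_sumr -sumrB; apply: eq_bigr => u _; ring.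
  rewrite ff; lra.
have t1 u v : 0 <= (adj u v)%:R * (f u + f v) ^+ 2.
  by rewrite mulr_ge0 ?ler0n ?sqr_ge0.
have t2 u : 0 <= (2 - #|adj u|%:R) * (f u * f u).
  by rewrite mulr_ge0 ?subr_ge0 ?(ler_nat R _ 2)// -expr2 sqr_ge0.
have S1_ge0 : 0 <= S1 by apply: sumr_ge0 => u _; apply: sumr_ge0.
have S2_ge0 : 0 <= S2 by apply: sumr_ge0.
have alt u v : adj u v -> f u = - f v.
  move=> uv; have /psum2_eq0 : S1 <= 0 by lra.
  move=> /(_ t1 u v) /eqP.
  by rewrite uv mul1r sqrf_eq0 addr_eq0 => /eqP.
have [r leafr] := tree_leaf treeG G1.
have fr : f r = 0.
  have /eqP : S2 = 0 by lra.
  rewrite psumr_eq0// => /allP /(_ r); rewrite mem_index_enum => /(_ isT) /=.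
  have dr : (#|adj r| <= 1)%N by apply/card_le1_eqP => u u' ? ?; exact: leafr.
  rewrite !mulf_eq0 orbb => /orP[|/eqP//].
  by rewrite subr_eq0 eqr_nat => /eqP dE; rewrite -dE in dr.
have f_0 x : f x = 0.
  have /connectP[p] := treeG.1 r x.
  elim: p r fr {leafr} => [|y p IH] z fz /= => [_ -> //|/andP[zy yp]].
  by apply: IH yp; apply/eqP; rewrite -oppr_eq0 -(alt _ _ zy) fz.
by move: ff; rewrite /inner big1 => [/eqP|x _]; rewrite ?f_0 ?mulr0// eq_sym oner_eq0.
Qed.

(** Homogeneous form of the maximum, which admits test vectors of any norm. *)
Lemma QEC_rayleigh (R : realType) (G : sgraph) (f : {ffun G -> R}) :
  (1 < #|G|)%N -> inner (ones R G) f = 0 ->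
  inner f (dist_op f) <= QEC R G * inner f f.
Proof.
move=> G1 f0; have [_ mx] := QEC_is_max R G1.
have [ff0|ffN0] := eqVneq (inner f f) 0.
  have f_0 x : f x = 0.
    move/eqP: ff0; rewrite psumr_eq0 => [|y _]; last by rewrite -expr2 sqr_ge0.
    move=> /allP /(_ x); rewrite mem_index_enum => /(_ isT) /=.
    by rewrite mulf_eq0 orbb => /eqP.
  by rewrite ff0 mulr0 /inner big1// => x _; rewrite f_0 mul0r.
have ff_gt0 : 0 < inner f f.
  by rewrite lt_def ffN0; apply: sumr_ge0 => x _; rewrite -expr2 sqr_ge0.
pose c := (Num.sqrt (inner f f))^-1.
have c2 : c * c = (inner f f)^-1.
  by rewrite -expr2 exprVn sqr_sqrtr ?ltW.
have /mx : admissible [ffun x => c * f x].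
  split; rewrite /inner.
    under eq_bigr do rewrite ffunE mulrACA c2.
    by rewrite -mulr_sumr mulVf.
  rewrite -[RHS](mulr0 c) -[in RHS]f0 mulr_sumr.
  by apply: eq_bigr => x _; rewrite !ffunE; ring.
have DZ x : dist_op [ffun x => c * f x] x = c * dist_op f x.
  by rewrite !ffunE mulr_sumr; apply: eq_bigr => w _; rewrite ffunE; ring.
have -> : inner [ffun x => c * f x] (dist_op [ffun x => c * f x]) =
    inner f (dist_op f) / inner f f.
  rewrite -c2 /inner mulr_suml; apply: eq_bigr => x _.
  by rewrite DZ !ffunE; ring.
by rewrite ler_pdivrMr.
Qed.

(** An induced star with k leaves has the test vector k at the centre and -1 at
    the leaves, of squared norm k (k + 1). Distances are 1 between centre and
    leaves and at least 2 between leaves, so its distance form is at least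
    - 2 k^2 + 2 k (k - 1) = - 2 k. *)
Lemma QEC_ge_star (R : realType) (G : sgraph) (conG : connected_graph G)
    (c : G) (A : {set G}) :
  (0 < #|A|)%N -> {in A, forall a, adj c a} ->
  {in A &, forall a b, a != b -> ~~ adj a b} ->
  - 2 / #|A|.+1%:R <= QEC R G.
Proof.
move=> A0 cA nA; set k : R := #|A|%:R.
have cNA : c \notin A by apply/negP => /cA; rewrite adj_irr.
pose f : {ffun G -> R} := [ffun x => k * (x == c)%:R - (x \in A)%:R].
have sumf (F : G -> R) : \sum_x F x * f x = k * F c - \sum_(a in A) F a.
  transitivity (k * \sum_x F x * (x == c)%:R - \sum_x F x * (x \in A)%:R).
    rewrite mulr_sumr -sumrB; apply: eq_bigr => x _; rewrite ffunE; ring.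
  rewrite (bigD1 c)//= eqxx big1 ?addr0 ?mulr1 => [|x /negbTE ->]; last by rewrite mulr0.
  congr (_ - _); rewrite [RHS]big_mkcond; apply: eq_bigr => x _.
  by case: ifP; rewrite ?mulr1 ?mulr0.
have fc : f c = k by rewrite ffunE eqxx (negbTE cNA) mulr1 subr0.
have fa a : a \in A -> f a = - 1.
  move=> aA; rewrite ffunE aA; have /negbTE -> : a != c by apply: contraTneq aA => ->.
  by rewrite mulr0 sub0r.
have sumA (F : G -> R) (z : R) : {in A, forall a, F a = z} -> \sum_(a in A) F a = k * z.
  by move=> Fz; rewrite (eq_bigr _ Fz) sumr_const mulr_natl.
have f0 : inner (ones R G) f = 0.
  by rewrite /inner sumf (sumA _ 1) => [|a _]; rewrite ffunE// subrr.
have ff : inner f f = k * (k + 1).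
  by rewrite /inner sumf fc (sumA _ _ fa); ring.
have Dc : dist_op f c = - k.
  rewrite ffunE sumf (sumA _ 1) => [|a aA];
    last by rewrite /dist_entry (gdist_adj conG (cA _ aA)).
  by rewrite /dist_entry gdist_refl; ring.
have Da a : a \in A -> dist_op f a <= 2 - k.
  move=> aA; rewrite ffunE sumf (bigD1 a)//= /dist_entry gdist_refl add0r.
  rewrite gdist_sym// (gdist_adj conG (cA _ aA)) mulr1.
  have : \sum_(b in A | b != a) 2 <= \sum_(b in A | b != a) (gdist a b)%:R :> R.
    apply: ler_sum => b /andP[bA ba]; rewrite (ler_nat _ 2) gdist_ge2//;
      first by rewrite eq_sym.
    by rewrite nA// eq_sym.
  have : \sum_(b in A) 2 = 2 * k :> R by rewrite (sumA _ 2)// mulrC.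
  by rewrite (bigD1 a)//=; lra.
have G1 : (1 < #|G|)%N.
  have /card_gt0P[a aA] := A0; apply/card_gt1P; exists c, a; split=> //.
  by apply: contraNneq cNA => ->.
have k0 : 0 < k by rewrite ltr0n.
have fDf : - (2 * k) <= inner f (dist_op f).
  rewrite /inner; under eq_bigr do rewrite mulrC.
  rewrite sumf Dc.
  have : \sum_(a in A) dist_op f a <= \sum_(a in A) (2 - k) by apply: ler_sum.
  by rewrite (sumA (fun=> 2 - k) (2 - k))//; lra.
have := le_trans fDf (QEC_rayleigh G1 f0); rewrite ff => le.
rewrite -natr1 -/k ler_pdivrMr ?addr_gt0// -(ler_pM2l k0); lra.
Qed.

Theorem theorem1p2 (R : realType) (n : nat) (hn : (4 <= n)%N)
    (T : sgraph) (treeT : is_tree T) (cardT : #|T| = n) :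
  (QEC R (path_graph n) <= QEC R T <= QEC R (complete_bipartite 1 (n - 1))) /\
  (QEC R (path_graph n) = QEC R T <-> graph_iso T (path_graph n)) /\
  (QEC R T = QEC R (complete_bipartite 1 (n - 1)) <->
     graph_iso T (complete_bipartite 1 (n - 1))).
Proof.
have T1 : (1 < #|T|)%N by lia.
(* A tree that is not a path has a vertex with three neighbours, and K_(1,3)
   already gives -1/2, above the value of every path. *)
have PT : graph_iso T (path_graph n) \/ QEC R (path_graph n) < QEC R T.
  have [deg2|] := boolP [forall x : T, #|adj x| <= 2]%N.
    by left; rewrite -cardT; apply: tree_iso_path_graph => // x; exact: (forallP deg2).
  case/forallPn => c; rewrite -ltnNge => deg3; right.
  have lt : QEC R (path_graph n) < - 1 / 2.
    apply: (tree_QEC_lt_degree2 _ (path_graph_tree n)) => [|i].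
      by rewrite card_ord; lia.
    exact: path_graph_degree.
  apply: lt_le_trans lt _.
  have /card_gt2P[a1 [a2 [a3 [[ca1 ca2 ca3] [a12 a23 a31]]]]] := deg3.
  have cA : {in [set a1; a2; a3], forall a, adj c a}.
    by move=> a; rewrite !inE => /orP[/orP[]|] /eqP ->.
  have cardA : #|[set a1; a2; a3]| = 3%N.
    by rewrite finset.setUC cardsU1 cards2 a12 !inE negb_or a31 eq_sym a23.
  have := @QEC_ge_star R T treeT.1 c [set a1; a2; a3].
  rewrite cardA {cardA} => /(_ isT cA) H; apply: le_trans (H _); first by lra.
  move=> a b aA bA ab; apply/negP => adjab.
  exact: (tree_no_triangle treeT (cA _ aA) adjab (cA _ bA)).
have Kge : - 2 / n%:R <= QEC R (complete_bipartite 1 (n - 1)).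
  pose K := complete_bipartite 1 (n - 1); pose z : K := inl ord0.
  have conK : connected_graph K.
    have zx (x : K) : connect (@adj K) z x.
      by case: x => [i|i]; [rewrite (ord1 i)|exact: connect1].
    move=> x y; apply: connect_trans (zx y).
    by rewrite (sym_connect_sym (@adj_sym K)).
  have cardA : #|~: [set z]| = n.-1.
    by rewrite cardsC1 card_sum !card_ord; lia.
  have := @QEC_ge_star R K conK z (~: [set z]); rewrite cardA.
  have -> : n.-1.+1 = n by lia.
  apply; first by lia.
    by case=> [i|//]; rewrite (ord1 i) !inE eqxx.
  by move=> [i|i] [j|j]; rewrite ?(ord1 i) ?(ord1 j) !inE ?eqxx.
have Tle := tree_QEC_le R treeT T1; rewrite cardT in Tle.
split; first apply/andP; [split|split; split].
- by case: PT => [/(QEC_iso R) ->|/ltW].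
- exact: le_trans Tle Kge.
- by case: PT => // /lt_eqF + E; rewrite E eqxx.
- by move/(QEC_iso R).
- move=> TK; have [|c cen] := @tree_QEC_extremal_center R T treeT T1.
    by rewrite cardT TK.
  by rewrite -cardT; exact: tree_iso_star cen.
- exact: QEC_iso.
Qed.
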